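(* Let the underlying graph to $L$ be unweighted with girth at least $5$. Then $L$ satisfies $CD_\Upsilon(0,\infty)$ if and only if the underlying graph is either a (finite or infinite) path or a cycle of length at least $5$.
   Context: Setting. $X$ is a finite or countably infinite set and $k:X\times X\to\mathbb{R}$ are transition rates: $k(x,y)\ge 0$ for $x\neq y$ and $k(x,x)=-\sum_{y\neq x}k(x,y)<0$. The generator is $Lf(x)=\sum_{y\in X}k(x,y)(f(y)-f(x))$. Standing assumptions: the chain is irreducible (for all $x,y\in X$ there are $x=z_1,\dots,z_m=y$, $m\ge2$, with $k(z_i,z_{i+1})>0$); it has an invariant measure $\mu$, unique up to positive multiples, with density $\pi:X\to(0,\infty)$ with respect to counting measure; detailed balance $\pi(x)k(x,y)=\pi(y)k(y,x)$ holds; and for every $x\in X$, $\sum_{y\neq x}k(x,y)<\infty$ and $\sum_{y\neq x}k(x,y)\sum_{z\neq y}k(y,z)<\infty$. Underlying graph. The underlying graph to $L$ has vertex set $X$, with $x\neq y$ adjacent iff $k(x,y)>0$ (equivalently $k(y,x)>0$), and edge weights $k(x,y)$; it is connected. It is unweighted if $k(x,y)\in\{0,1\}$ for all $x\ne y$. Its girth is the length of its shortest cycle ($\infty$ if there is no cycle). Infinite paths may be one-sided or two-sided. Curvature condition. With $\Upsilon(r)=e^r-1-r$, set $\Psi_\Upsilon(f)(x)=\sum_{y}k(x,y)\Upsilon(f(y)-f(x))$, $B_{\Upsilon'}(f,g)(x)=\sum_y k(x,y)\Upsilon'(f(y)-f(x))(g(y)-g(x))$, $\Psi_{2,\Upsilon}(f)=\frac12\big(L\Psi_\Upsilon(f)-B_{\Upsilon'}(f,Lf)\big)$.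 $L$ satisfies $CD_\Upsilon(\kappa,\infty)$ if $\Psi_{2,\Upsilon}(f)(x)\ge\kappa\Psi_\Upsilon(f)(x)$ for all $x\in X$ and all bounded $f:X\to\mathbb{R}$. *)

(* Defs.v *)
From mathcomp Require Import all_boot all_order all_algebra.
From mathcomp Require Import all_classical all_reals all_analysis.
Set Implicit Arguments.
Unset Strict Implicit.
Unset Printing Implicit Defensive.
Import Order.TTheory GRing.Theory Num.Theory.
Import numFieldNormedType.Exports.
Local Open Scope classical_set_scope.
Local Open Scope ring_scope.

(* Sum of an absolutely summable real family; [\esum] is only meaningful for
   nonnegative terms, hence the split into positive and negative parts.  The
   value is not meaningful when the family is not absolutely summable. *)
Definition rsum (R : realType) (X : choiceType) (a : X -> R) : R :=
  fine (\esum_(x in [set: X]) (a^\+ x)%:E)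
  - fine (\esum_(x in [set: X]) (a^\- x)%:E).

Section Chain.
Variables (R : realType) (X : countType).
Implicit Types (k : X -> X -> R) (rho : X -> R) (f g : X -> R).

Definition out_rate k (x : X) : \bar R := \esum_(y in [set~ x]) (k x y)%:E.

Definition transition_rates k : Prop :=
  (forall x y, x != y -> 0 <= k x y)
  /\ (forall x, (k x x)%:E = (- out_rate k x)%E /\ k x x < 0).

Definition irreducible_chain k : Prop :=
  forall x y, exists p : seq X,
    [/\ p != [::], path (fun a b => 0 < k a b) x p & last x p = y].

(* The measure with density rho is nonzero and satisfies
   sum_x rho(x) k(x,y) = 0 for every y, where the (negative) diagonal term is
   moved to the other side so that all sums have nonnegative terms. *)
Definition invariant_density k rho : Prop :=
  [/\ forall x, 0 <= rho x,
      exists x, rho x != 0 &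
      forall y, (\esum_(x in [set~ y]) (rho x * k x y)%:E
                 = (rho y * - k y y)%:E)%E].

Record chain_assumptions k (pi : X -> R) : Prop := ChainAssumptions {
  chain_rates : transition_rates k;
  chain_irreducible : irreducible_chain k;
  chain_pi_gt0 : forall x, 0 < pi x;
  chain_pi_invariant : invariant_density k pi;
  chain_pi_unique : forall rho, invariant_density k rho ->
    exists2 c : R, 0 < c & forall x, rho x = c * pi x;
  chain_detailed_balance : forall x y, pi x * k x y = pi y * k y x;
  chain_summable1 : forall x, (out_rate k x < +oo)%E;
  chain_summable2 : forall x,
    (\esum_(y in [set~ x]) ((k x y)%:E * out_rate k y) < +oo)%E
}.

Definition generator k f (x : X) : R := rsum (fun y => k x y * (f y - f x)).

Definition Upsilon (r : R) : R := expR r - 1 - r.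

Definition Psi_Upsilon k f (x : X) : R :=
  rsum (fun y => k x y * Upsilon (f y - f x)).

Definition B_Upsilon' k f g (x : X) : R :=
  rsum (fun y => k x y * derive1 Upsilon (f y - f x) * (g y - g x)).

Definition Psi2_Upsilon k f (x : X) : R :=
  2^-1 * (generator k (Psi_Upsilon k f) x - B_Upsilon' k f (generator k f) x).

(* CD_Upsilon(kappa, oo) *)
Definition CD_Upsilon_infty k (kappa : R) : Prop :=
  forall f, (exists M : R, forall x, `|f x| <= M) ->
  forall x, kappa * Psi_Upsilon k f x <= Psi2_Upsilon k f x.

Definition underlying_graph k : rel X :=
  fun x y => (x != y) && (0 < k x y).

Definition unweighted k : Prop :=
  forall x y, x != y -> k x y = 0 \/ k x y = 1.

End Chain.

(* The infimum of the lengths of the cycles of the graph e, so +oo if there is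
   none.  A cycle is listed by its pairwise distinct vertices. *)
Definition girth (R : realType) (X : eqType) (e : rel X) : \bar R :=
  ereal_inf [set ((size s)%:R)%:E | s in
    [set s : seq X | ucycle e s /\ (2 < size s)%N]].

Definition graph_iso (X Y : Type) (e : rel X) (e' : rel Y) : Prop :=
  exists2 h : X -> Y, bijective h & forall x y, e' (h x) (h y) = e x y.

Definition fin_path_graph (n : nat) : rel 'I_n :=
  fun i j => (i.+1 == j :> nat) || (j.+1 == i :> nat).

Definition one_sided_path_graph : rel nat :=
  fun i j => (i.+1 == j) || (j.+1 == i).

Definition two_sided_path_graph : rel int :=
  fun i j => (i + 1 == j) || (j + 1 == i).

(* Only used for n >= 3. *)
Definition cycle_graph (n : nat) : rel 'I_n :=
  fun i j => (i.+1 %% n == j)%N || (j.+1 %% n == i)%N.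

Definition is_path_graph (X : Type) (e : rel X) : Prop :=
  [\/ exists2 n : nat, (0 < n)%N & graph_iso e (@fin_path_graph n),
      graph_iso e one_sided_path_graph
    | graph_iso e two_sided_path_graph].

(* Main.v *)
(* On a graph of girth at least 5 the values of [f] on the ball of radius 2
   around [x] can be prescribed freely.  If [x] has three neighbours, choose [f]
   constant on each branch at [x], equal to [t] on one of them, to [1 - t] on two
   others and to [0] on the rest: [Psi2_Upsilon k f x] is negative for [t = 6].
   If all degrees are at most 2, the Fenchel--Young inequality for [Upsilon]
   bounds the second-order terms at [x], and for two neighbours with increments
   [a], [b] one is left with
   [(e^a + e^b) (e^-(a+b) - 1 + (a+b)) >= 0].  So the curvature condition means
   that all degrees are at most 2; a non-backtracking walk then traces out the
   whole connected graph, which is a path or a cycle. *)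
Require Import Defs.
From mathcomp Require Import all_boot all_order all_algebra.
From mathcomp Require Import all_classical all_reals all_analysis.
From mathcomp Require Import zify ring lra.
Set Implicit Arguments.
Unset Strict Implicit.
Unset Printing Implicit Defensive.
Import Order.TTheory GRing.Theory Num.Theory.
Local Open Scope classical_set_scope.
Local Open Scope ring_scope.

(** * Connected graphs of maximal degree two *)

Section MaxDegreeTwo.
Variables (X : choiceType) (e : rel X).
Implicit Types x y z w : X.

Definition max_deg2 :=
  forall x a b c, e x a -> e x b -> e x c -> [\/ a = b, a = c | b = c].

Lemma max_deg2_iso (Y : eqType) (e' : rel Y) :
  (forall i a b c, e' i a -> e' i b -> e' i c -> [|| a == b, a == c | b == c]) ->
  graph_iso e e' -> max_deg2.
Proof.
move=> deg [h /bij_inj h_inj he] x a b c; rewrite -!he => ea eb ec.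
by have /or3P[] := deg _ _ _ _ ea eb ec => /eqP /h_inj ->;
  [apply: Or31|apply: Or32|apply: Or33].
Qed.

Lemma path_graph_max_deg2 : is_path_graph e -> max_deg2.
Proof.
case=> [[n _]||]; apply: max_deg2_iso => i a b c;
  rewrite /fin_path_graph /one_sided_path_graph /two_sided_path_graph -?val_eqE /=;
  lia.
Qed.

Lemma cycle_graph_max_deg2 n : graph_iso e (@cycle_graph n) -> max_deg2.
Proof.
apply: max_deg2_iso => i a b c; rewrite /cycle_graph -!val_eqE /=.
have modS (j : 'I_n) : (j.+1 %% n = if j.+1 == n then 0 else j.+1)%N.
  case: eqP => [->|]; first exact: modnn.
  by have := ltn_ord j; move=> ? ?; rewrite modn_small //; lia.
rewrite !modS; have := ltn_ord i; have := ltn_ord a; have := ltn_ord b.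
by have := ltn_ord c; repeat case: ifP; lia.
Qed.

Hypothesis e_sym : symmetric e.
Hypothesis e_irr : irreflexive e.
Hypothesis e_conn : forall x y, exists p, path e x p /\ last x p = y.

(** The image of [h] contains [h i0] and, by the last hypothesis, all neighbours of its points, so
    connectedness makes [h] surjective. The same hypothesis and injectivity turn edges of [e] back
    into edges of [e']. *)
Lemma closed_iso (I : Type) (e' : rel I) (h : I -> X) (i0 : I) :
    injective h -> (forall i j, e' i j -> e (h i) (h j)) ->
    (forall i w, e (h i) w -> exists2 j, e' i j & w = h j) ->
  graph_iso e e'.
Proof.
move=> h_inj he hcl.
have h_surj y : exists i, h i = y.
  have [p [+ <-]] := e_conn (h i0) y.
  elim: p i0 => [|w p IHp] i /=; first by exists i.
  by move=> /andP[/hcl[j _ ->]]; exact: IHp.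
pose g y := projT1 (cid (h_surj y)).
have gK : cancel g h by move=> y; rewrite /g; case: cid.
have hK : cancel h g by move=> i; apply: h_inj; rewrite gK.
exists g; first by exists h.
move=> x y; apply/idP/idP => [/he|]; rewrite ?gK //.
by rewrite -{1}(gK x) => /hcl[j ? ->]; rewrite hK.
Qed.

Lemma max_deg2E (deg2 : max_deg2) x a b w : e x a -> e x b -> a <> b -> e x w ->
  w = a \/ w = b.
Proof.
by move=> ea eb ab ew; case: (deg2 _ _ _ _ ea eb ew) => // ->; [left|right].
Qed.

(** * Non-backtracking walks *)

Definition other_nbr p c : X := xget c [set w | e c w /\ w <> p].

(** The state is the pair of previous and current vertex. At a dead end [xget] returns the current
    vertex, so the walk is total; [ray_step] says that this did not happen. *)
Definition walk x0 x1 n : X * X :=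
  iter n (fun pc => (pc.2, other_nbr pc.1 pc.2)) (x0, x1).

Definition ray x0 x1 n : X := (walk x0 x1 n).1.

Lemma ray1 x0 x1 : ray x0 x1 1 = x1. Proof. by []. Qed.
Lemma rayS x0 x1 n :
  ray x0 x1 n.+2 = other_nbr (ray x0 x1 n) (ray x0 x1 n.+1).
Proof. by []. Qed.

Definition ray_step x0 x1 n :=
  e (ray x0 x1 n.+1) (ray x0 x1 n.+2) /\ ray x0 x1 n.+2 <> ray x0 x1 n.

Lemma ray_stepP x0 x1 n w : e (ray x0 x1 n.+1) w -> w <> ray x0 x1 n ->
  ray_step x0 x1 n.
Proof.
move=> ew wn; rewrite /ray_step rayS /other_nbr; set W := [set _ | _].
by have [] : W (xget (ray x0 x1 n.+1) W) by apply: (xgetI _ (conj ew wn)).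
Qed.

Lemma ray_edge x0 x1 N : e x0 x1 ->
  (forall n, (n < N)%N -> ray_step x0 x1 n) ->
  forall n, (n <= N)%N -> e (ray x0 x1 n) (ray x0 x1 n.+1).
Proof. by move=> e01 st [|n] nN //; case: (st n nN). Qed.

Lemma ray_nbr x0 x1 N (deg2 : max_deg2) : e x0 x1 ->
    (forall n, (n < N)%N -> ray_step x0 x1 n) ->
  forall n w, (n < N)%N -> e (ray x0 x1 n.+1) w ->
  w = ray x0 x1 n \/ w = ray x0 x1 n.+2.
Proof.
move=> e01 st n w nN; have [e1 ne] := st n nN.
have e2 : e (ray x0 x1 n.+1) (ray x0 x1 n).
  by rewrite e_sym; apply: (ray_edge e01 st); lia.
by apply: max_deg2E => // /esym.
Qed.

(** Induction on [j]: if [r i = r j.+1], then [r j] is a neighbour of [r i], hence [r i.-1] or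
    [r i.+1] (only [r 1] if [i = 0], as [x0] is a leaf). This is an earlier repetition, a backtrack
    or a loop. *)
Lemma ray_leaf_inj x0 x1 N (deg2 : max_deg2) : e x0 x1 ->
    (forall w, e x0 w -> w = x1) ->
    (forall n, (n < N)%N -> ray_step x0 x1 n) ->
  forall j i, (i < j)%N -> (j <= N.+1)%N -> ray x0 x1 i <> ray x0 x1 j.
Proof.
move=> e01 leaf st; set r := ray x0 x1.
have ed n : (n <= N)%N -> e (r n) (r n.+1) by exact: ray_edge.
elim=> [|j IHj] i // ij jN rij.
have ej : e (r i) (r j) by rewrite rij e_sym; apply: ed.
have ne m : m.+1 = j -> r m <> r j.+1.
  by move=> mj; have [_ +] := st m ltac:(lia); rewrite -mj => + /esym.
have loop m n : m = n -> ~~ e (r m) (r n) by move=> ->; rewrite e_irr.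
case: i => [|i] in ij rij ej *.
  have /esym := leaf _ ej; rewrite -(ray1 x0 x1) -/r.
  case: j => [|[|j]] in IHj ij jN rij ej ne *.
  - by move=> _; move: ej; rewrite e_irr.
  - by move=> _; apply: (ne 0%N).
  - by apply: IHj => //; lia.
case: (ray_nbr deg2 e01 st _ ej); rewrite -/r; first lia.
  by move/esym; apply: IHj; lia.
have [ij1|] := ltnP i.+2 j; first by move/esym; apply: IHj; lia.
have [/ne //|ij1 ij2 _] := eqVneq i.+2 j.
by move: ej; apply/negP/loop; lia.
Qed.

(** Walk away from the leaf. If every step succeeds, the vertices form a one-sided path; otherwise
    the first stuck step ends a finite one. *)
Lemma leaf_path_graph x0 x1 (deg2 : max_deg2) : e x0 x1 ->
  (forall w, e x0 w -> w = x1) -> is_path_graph e.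
Proof.
move=> e01 leaf; set r := ray x0 x1.
have [st|/existsNP stuck] := pselect (forall n, ray_step x0 x1 n).
  apply: Or32; apply: (@closed_iso _ _ r 0%N).
  - move=> i j; case: (ltngtP i j) => // ij rij; exfalso.
      by apply: (ray_leaf_inj deg2 e01 leaf (N := j) _ ij).
    by apply: (ray_leaf_inj deg2 e01 leaf (N := i) _ ij).
  - have ed n : e (r n) (r n.+1) by apply: (ray_edge (N := n)) => // m _.
    by move=> i j /orP[] /eqP <-; rewrite // e_sym.
  - rewrite /one_sided_path_graph => -[|n] w.
      by move/leaf ->; exists 1%N; rewrite ?eqxx.
    case/(ray_nbr deg2 e01 (N := n.+1)) => // ->; [exists n|exists n.+2] => //=.
      by rewrite eqxx orbT.
    by rewrite eqxx.
have {}stuck : exists n, ~~ `[< ray_step x0 x1 n >].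
  by have [n ?] := stuck; exists n; apply/asboolPn.
have [N /asboolPn stN minN] := ex_minnP stuck.
have {minN}st n : (n < N)%N -> ray_step x0 x1 n.
  by move=> nN; apply/asboolP; apply: contraTT nN => /minN; rewrite -leqNgt.
(* Step [N] would choose vertex [N.+2] and is the first to fail, so the vertices are [r 0], ...,
   [r N.+1]. *)
apply: Or31; exists N.+2 => //; apply: (@closed_iso _ _ (r \o val) ord0).
- move=> i j /= rij; apply/val_inj => /=; have := ltn_ord i; have := ltn_ord j.
  case: (ltngtP i j) => // ij jN iN; exfalso.
    by apply: (ray_leaf_inj deg2 e01 leaf st ij).
  by apply: (ray_leaf_inj deg2 e01 leaf st ij).
- have ed n : (n <= N)%N -> e (r n) (r n.+1) by exact: ray_edge.
  move=> i j /=; have := ltn_ord i; have := ltn_ord j.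
  by move=> ? ? /orP[] /eqP ij; rewrite -ij; [|rewrite e_sym]; apply: ed; lia.
- move=> -[[|i] iN] w /=.
    by move/leaf ->; exists (@Ordinal N.+2 1 isT).
  have [iN1|iN1] := ltnP i N.
    case/(ray_nbr deg2 e01 st iN1) => ->.
      exists (Ordinal (ltnW iN)) => //.
      by rewrite /fin_path_graph /= eqxx orbT.
    have iN2 : (i.+2 < N.+2)%N by [].
    by exists (Ordinal iN2) => //; rewrite /fin_path_graph /= eqxx.
  (* At the last vertex, a neighbour other than its predecessor would make step [N] succeed. *)
  move=> ei; have [->|/eqP wi] := eqVneq w (r i).
    by exists (Ordinal (ltnW iN)); rewrite /fin_path_graph //= eqxx orbT.
  case: stN; have -> : N = i by lia.
  exact: ray_stepP ei wi.
Qed.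

(** * Two-sided walks: infinite paths and cycles *)

Section BiInfiniteWalk.
Variable u : int -> X.
Hypothesis u_edge : forall i, e (u i) (u (i + 1)).
Hypothesis u_nbr : forall i w, e (u i) w -> w = u (i - 1) \/ w = u (i + 1).

Lemma walk_two_sided_path : injective u -> graph_iso e two_sided_path_graph.
Proof.
move=> u_inj; apply: (@closed_iso _ _ u 0) => //.
- by rewrite /two_sided_path_graph => i j /orP[] /eqP <- //; rewrite e_sym.
- move=> i w /u_nbr[] ->; [exists (i - 1)|exists (i + 1)] => //;
    rewrite /two_sided_path_graph; lia.
Qed.

Hypothesis u_nobacktrack : forall i, u (i + 2) <> u i.
Hypothesis e_girth : forall s, ucycle e s -> (2 < size s)%N -> (5 <= size s)%N.

(* The cycle is a shortest closed segment [u i, ..., u (i + n) = u i]. *)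
Lemma walk_cycle : ~ injective u ->
  exists2 n, (5 <= n)%N & graph_iso e (@cycle_graph n).
Proof.
move=> /existsNP[i0 /existsNP[j0 /not_implyP[uij0 /eqP ij0]]].
have ex_n : exists n, `[< exists i, u i = u (i + n.+1%:Z) >].
  (* Closed segments have length [n.+1], which excludes length zero. *)
  exists (`|j0 - i0|%N.-1); apply/asboolP.
  have [ij|ij] := leP i0 j0; [exists i0|exists j0].
    by rewrite uij0; congr u; lia.
  by rewrite -uij0; congr u; lia.
have [m /asboolP[i0' um] minm] := ex_minnP ex_n.
move: i0' um => {ij0 uij0 j0}i um {i0}.
pose v (n : nat) := u (i + n%:Z).
have v_edge n : e (v n) (v n.+1).
  by rewrite /v (_ : _ + n.+1%:Z = i + n%:Z + 1) //; lia.
have v0m : v m.+1 = v 0%N by rewrite /v addr0 -um.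
have v_inj a b : (a < b)%N -> (b < m.+1)%N -> v a <> v b.
  move=> ab bm vab; suff : (m <= b - a.+1)%N by lia.
  apply: minm; apply/asboolP; exists (i + a%:Z); rewrite -/(v a) vab /v.
  by congr u; lia.
(* Length one would be a loop and length two a backtrack. *)
have m2 : (2 <= m)%N.
  case: m => [|[|//]] in v0m {um minm v_inj} *.
    by have := v_edge 0%N; rewrite v0m e_irr.
  by have := @u_nobacktrack i; move: v0m; rewrite /v addr0 => ->.
have m5 : (5 <= m.+1)%N.
  pose s := [seq v n | n <- iota 0 m.+1].
  have -> : m.+1 = size s by rewrite size_map size_iota.
  apply: e_girth; last by rewrite size_map size_iota.
  apply/andP; split.
    rewrite /s /= -v0m -map_rcons -cats1 -(iotaD 1 m 1)%N addn1 /=.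
    have pth l k : path e (v k) (map v (iota k.+1 l)).
      by elim: l k => [|l IHl] k //=; rewrite v_edge IHl.
    by rewrite v0m; exact: (pth m.+1 0%N).
  rewrite map_inj_in_uniq ?iota_uniq // => a b; rewrite !mem_iota => am bm vab.
  by case: (ltngtP a b) => // ab; exfalso; apply: v_inj ab _ _ => //; lia.
exists m.+1 => //; apply: (@closed_iso _ _ (v \o val) ord0).
- move=> a b /= vab; apply/val_inj => /=.
  by case: (ltngtP a b) => // ab; exfalso; apply: v_inj ab _ _ => //;
    have := ltn_ord a; have := ltn_ord b; lia.
- have modS (j : 'I_m.+1) : v (j.+1 %% m.+1)%N = v j.+1.
    have [->|jm] := eqVneq j.+1 m.+1; first by rewrite modnn v0m.
    by rewrite modn_small //; have := ltn_ord j; lia.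
  move=> a b /= /orP[] /eqP <-; rewrite modS; first exact: v_edge.
  by rewrite e_sym v_edge.
- move=> a w /= /u_nbr [] ->.
    (* At [a = 0] the walk only provides [u (i - 1)]; since [v m] is a neighbour of [u i] other than
       [v 1], it is that vertex. *)
    have [a0|a0] := eqVneq (a : nat) 0%N.
      have vm1 : v m <> v 1%N by move/esym; apply: v_inj => //; lia.
      have : e (u i) (v m).
        by rewrite e_sym um -/(v m.+1) v_edge.
      case/u_nbr => [vm|vm]; last by case: vm1.
      exists ord_max; first by rewrite /cycle_graph /= a0 modnn eqxx orbT.
      by rewrite a0 /= vm addr0.
    have am : (a.-1 < m.+1)%N by have := ltn_ord a; lia.
    exists (Ordinal am).
      by rewrite /cycle_graph /= prednK ?lt0n // (modn_small (ltn_ord a)) eqxx orbT.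
    by rewrite /= /v; congr u; lia.
  have -> : u (i + a%:Z + 1) = v a.+1 by rewrite /v; congr u; lia.
  have [am|am] := eqVneq (a : nat) m.
    by exists ord0; rewrite /cycle_graph /= am ?modnn.
  have am1 : (a.+1 < m.+1)%N by have := ltn_ord a; lia.
  by exists (Ordinal am1) => //; rewrite /cycle_graph /= modn_small ?eqxx.
Qed.

End BiInfiniteWalk.

(** Two rays leaving [x0] in different directions are glued at [x0], the second one read
    backwards. *)
Lemma leafless_bi_infinite_walk x0 y1 y2 (deg2 : max_deg2) :
    e x0 y1 -> e x0 y2 -> y1 <> y2 ->
    (forall x a, e x a -> exists2 w, e x w & w <> a) ->
  exists u : int -> X, [/\ forall i, e (u i) (u (i + 1)),
    forall i w, e (u i) w -> w = u (i - 1) \/ w = u (i + 1) &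
    forall i, u (i + 2) <> u i].
Proof.
move=> ey1 ey2 ny br.
have st y n : e x0 y -> ray_step x0 y n.
  move=> ey; elim: n => [|n [en _]].
    have /br[w ew wn] : e (ray x0 y 1) (ray x0 y 0) by rewrite e_sym.
    exact: ray_stepP ew wn.
  have /br[w ew wn] : e (ray x0 y n.+2) (ray x0 y n.+1) by rewrite e_sym.
  exact: ray_stepP ew wn.
have ed y n : e x0 y -> e (ray x0 y n) (ray x0 y n.+1).
  by move=> ey; apply: (ray_edge ey (N := n)) => // m _; apply: st.
pose u i := match i with Posz n => ray x0 y1 n | Negz n => ray x0 y2 n.+1 end.
have uN n : u (- n%:Z) = ray x0 y2 n by case: n.
have u_edge i : e (u i) (u (i + 1)).
  case: i => n; first by rewrite (_ : Posz n + 1 = n.+1%:Z) ?ed //; lia.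
  by rewrite (_ : Negz n + 1 = - n%:Z) ?uN /= 1?e_sym ?ed //; lia.
have u_nb i : u (i + 2) <> u i.
  case: i => [n|[|n]].
  - rewrite (_ : Posz n + 2 = n.+2%:Z) /=; first by case: (st y1 n ey1).
    lia.
  - by [].
  - rewrite (_ : Negz n.+1 + 2 = - n%:Z) ?uN; last lia.
    by apply/nesym; case: (st y2 n ey2).
exists u; split=> // i w ew.
apply: (max_deg2E deg2) ew => //.
  by rewrite e_sym -{2}(subrK 1 i) u_edge.
by have := u_nb (i - 1); rewrite (_ : i - 1 + 2 = i + 1) => [/nesym//|]; lia.
Qed.

(** With a leaf the graph is a path. Otherwise each vertex can be left by another edge than the one
    of arrival, and the two-sided walk is injective or closes up. *)
Lemma max_deg2_path_or_cycle (deg2 : max_deg2) (x : X) :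
    (forall y, exists z, e y z) ->
    (forall s, ucycle e s -> (2 < size s)%N -> (5 <= size s)%N) ->
  is_path_graph e \/ exists2 n, (5 <= n)%N & graph_iso e (@cycle_graph n).
Proof.
move=> deg1 e_girth.
have [[x0 [x1 [e01 leaf]]]|noleaf] :=
    pselect (exists x0 x1, e x0 x1 /\ forall w, e x0 w -> w = x1).
  by left; apply: leaf_path_graph e01 leaf.
have br y a : e y a -> exists2 w, e y w & w <> a.
  move=> ea; apply: contrapT => nw; apply: noleaf; exists y, a; split=> // w ew.
  by apply: contrapT => wa; apply: nw; exists w.
have [y1 ey1] := deg1 x; have [y2 ey2 /nesym ny] := br _ _ ey1.
have [u [u_edge u_nbr u_nb]] := leafless_bi_infinite_walk deg2 ey1 ey2 ny br.
have [u_inj|u_ninj] := pselect (injective u).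
  by left; apply: Or33; apply: walk_two_sided_path u_inj.
by right; apply: walk_cycle u_ninj.
Qed.

End MaxDegreeTwo.

(** * Curvature and degrees *)

Lemma esum_seq (R : realType) (X : choiceType) (s : seq X) (a : X -> R) :
    uniq s -> (forall x, 0 <= a x) -> (forall x, x \notin s -> a x = 0) ->
  (\esum_(x in [set: X]) (a x)%:E = (\sum_(x <- s) a x)%:E)%E.
Proof.
move=> s_uniq a_ge0 a0.
have -> : (\esum_(x in [set: X]) (a x)%:E = \esum_(x in [set` s]) (a x)%:E)%E.
  rewrite [RHS]esum_mkcond; apply: eq_esum => x _.
  by case: ifPn => //; rewrite mem_setE => /a0 ->.
rewrite esum_fset //; last by move=> x _; rewrite lee_fin.
by rewrite -fsbig_seq //= sumEFin.
Qed.

Lemma rsum_seq (R : realType) (X : choiceType) (s : seq X) (a : X -> R) :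
    uniq s -> (forall x, x \notin s -> a x = 0) ->
  rsum a = \sum_(x <- s) a x.
Proof.
move=> s_uniq a0; rewrite /rsum !(esum_seq s_uniq) //=.
- by rewrite -sumrB; apply: eq_bigr => x _; have /(congr1 (@^~ x)) := funrposBneg a.
- by move=> x /a0; rewrite /funrneg => ->; rewrite oppr0 maxxx.
- by move=> x /a0; rewrite /funrpos => ->; rewrite maxxx.
Qed.

Section Upsilon.
Variable R : realType.
Implicit Types a b t : R.

Lemma derive1_Upsilon a : derive1 (@Upsilon R) a = expR a - 1.
Proof.
rewrite derive1E.
have : is_derive a 1 (expR - cst 1 - id) (expR a - 0 - 1).
  exact: is_deriveB.
by move=> /@derive_val; rewrite subr0.
Qed.

Lemma Upsilon0 : @Upsilon R 0 = 0. Proof. by rewrite /Upsilon expR0; lra. Qed.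

Lemma Upsilon_ge0 a : 0 <= Upsilon a.
Proof. by have := expR_ge1Dx a; rewrite /Upsilon; lra. Qed.

(* Fenchel--Young inequality; equality holds at [b = a]. *)
Lemma Upsilon_young a b :
  expR a - 1 - a * expR a <= Upsilon b - (expR a - 1) * b.
Proof.
(* Factoring out [e^a] reduces the claim to [1 + (b - a) <= e^(b - a)]. *)
rewrite /Upsilon; have -> : expR b = expR a * expR (b - a).
  by rewrite -expRD addrC subrK.
have := expR_gt0 a; have := expR_ge1Dx (b - a); nra.
Qed.

End Upsilon.

(** * Curvature operators as finite sums over neighbours *)

Section LocallyFinite.
Variables (R : realType) (X : countType) (k : X -> X -> R) (N : X -> seq X).
Let e := underlying_graph k.
Hypothesis k_edge : forall x y, e x y -> k x y = 1.
Hypothesis k_nonedge : forall x y, x != y -> ~~ e x y -> k x y = 0.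
Hypothesis N_uniq : forall x, uniq (N x).
Hypothesis mem_N : forall x y, (y \in N x) = e x y.
Hypothesis e_sym : symmetric e.
Implicit Types (f g : X -> R) (x y z : X).

(** The condition [g x = 0] removes the diagonal term; every other rate is [1] on edges and [0]
    elsewhere. *)
Lemma rsum_nbrs g x : g x = 0 ->
  rsum (fun y => k x y * g y) = \sum_(y <- N x) g y.
Proof.
move=> gx; rewrite (rsum_seq (N_uniq x)).
  by apply: eq_big_seq => y; rewrite mem_N => /k_edge ->; rewrite mul1r.
move=> y; rewrite mem_N; have [<-|xy] := eqVneq x y; first by rewrite gx mulr0.
by move=> /(k_nonedge xy) ->; rewrite mul0r.
Qed.

Lemma generator_nbrs f x : generator k f x = \sum_(y <- N x) (f y - f x).
Proof. by rewrite /generator rsum_nbrs ?subrr. Qed.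

Lemma Psi_nbrs f x : Psi_Upsilon k f x = \sum_(y <- N x) Upsilon (f y - f x).
Proof. by rewrite /Psi_Upsilon rsum_nbrs ?subrr ?Upsilon0. Qed.

(** This is [Psi_Upsilon k f y] minus [Upsilon' (f y - f x) * generator k f y], the only part of the
    [y]-summand of [2 * Psi2_Upsilon k f x] that reaches vertices at distance two from [x]. *)
Definition second_nbrs_term f x y : R :=
  \sum_(z <- N y)
    (Upsilon (f z - f y) - (expR (f y - f x) - 1) * (f z - f y)).

Lemma Psi2_nbrs f x : 2 * Psi2_Upsilon k f x =
  \sum_(y <- N x) (second_nbrs_term f x y - Psi_Upsilon k f x
    + (expR (f y - f x) - 1) * generator k f x).
Proof.
rewrite /Psi2_Upsilon mulVKf ?pnatr_eq0 // generator_nbrs /B_Upsilon'.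
under [X in rsum X]eq_fun do rewrite -mulrA.
rewrite (@rsum_nbrs (fun y => derive1 (@Upsilon R) (f y - f x)
  * (generator k f y - generator k f x))); last first.
  by rewrite (subrr (generator k f x)) mulr0.
rewrite -sumrB; apply: eq_bigr => y _.
rewrite derive1_Upsilon /second_nbrs_term sumrB -mulr_sumr.
rewrite -Psi_nbrs -generator_nbrs; ring.
Qed.

Lemma second_nbrs_termE f x y : e x y -> second_nbrs_term f x y =
  Upsilon (f x - f y) + (expR (f y - f x) - 1) * (f y - f x) +
  \sum_(z <- rem x (N y))
    (Upsilon (f z - f y) - (expR (f y - f x) - 1) * (f z - f y)).
Proof.
rewrite e_sym -mem_N => /perm_to_rem xy.
by rewrite /second_nbrs_term (perm_big _ xy) big_cons /= -(opprB (f x)); ring.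
Qed.

Section MaxDeg2Curvature.
Hypothesis deg2 : max_deg2 e.

Lemma size_nbrs_le2 x : (size (N x) <= 2)%N.
Proof.
have := N_uniq x; have := mem_N x; case: (N x) => [|a [|b [|c s]]] //= m.
have ea : e x a by rewrite -m !inE eqxx.
have eb : e x b by rewrite -m !inE eqxx orbT.
have ec : e x c by rewrite -m !inE eqxx !orbT.
by case: (deg2 ea eb ec) => ->; rewrite !inE eqxx ?orbT ?andbF.
Qed.

(* At most one neighbour of [y] differs from [x]; with [a = f y - f x], its term is
   at least [e^a - 1 - a e^a <= 0]. *)
Lemma second_nbrs_term_ge f x y : e x y ->
  expR (f y - f x) + expR (f x - f y) - 2 <= second_nbrs_term f x y.
Proof.
move=> exy; rewrite second_nbrs_termE //.
have : (size (rem x (N y)) <= 1)%N.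
  by rewrite size_rem ?mem_N 1?e_sym //; have := size_nbrs_le2 y; case: size.
have -> : f x - f y = - (f y - f x) by rewrite opprB.
move: (f y - f x) => a; rewrite {1}/Upsilon.
(* If [y] has no neighbour but [x], the remaining sum is [0]; this sign covers that case. *)
have ga_le0 : expR a - 1 - a * expR a <= 0.
  by have := Upsilon_young a 0; rewrite Upsilon0 mulr0 subr0.
case: (rem _ _) => [|z [|//]] _; first by rewrite big_nil; lra.
by rewrite big_seq1; have := Upsilon_young a (f z - f y); lra.
Qed.

(** Replacing each second-order term by its lower bound leaves an expression in the increments along
    the at most two edges at [x]. *)
Lemma max_deg2_CD : CD_Upsilon_infty k 0.
Proof.
move=> f _ x; rewrite mul0r -(pmulr_rge0 _ (ltr0n _ 2)) Psi2_nbrs.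
pose A := generator k f x.
apply: le_trans (_ : _ <= \sum_(y <- N x) (expR (f y - f x) + expR (f x - f y)
    - 2 - Psi_Upsilon k f x + (expR (f y - f x) - 1) * A)) _; last first.
  rewrite big_seq [leRHS]big_seq; apply: ler_sum => y; rewrite mem_N => exy.
  by rewrite lerD2r lerB // second_nbrs_term_ge.
rewrite {}/A Psi_nbrs generator_nbrs.
case: (N x) (size_nbrs_le2 x) => [|y1 [|y2 [|//]]] _.
- by rewrite big_nil.
(* One neighbour with increment [a] leaves [(e^-a - 1 + a) + a (e^a - 1)], a sum of nonnegative
   terms. *)
- rewrite !big_seq1 -(opprB (f y1)) /Upsilon; move: (f y1 - f x) => a.
  have : 0 <= a * (expR a - 1).
    have [a_ge0|/ltW a_le0] := leP 0 a.
      by apply: mulr_ge0 => //; have := expR_ge1Dx a; lra.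
    by rewrite mulr_le0 // subr_le0 expR_le1.
  by have := expR_ge1Dx (- a); lra.
- rewrite !big_cons !big_nil !addr0.
  rewrite -(opprB (f y1)) -(opprB (f y2)) /Upsilon.
  move: (f y1 - f x) (f y2 - f x) => a b.
  (* Writing [e^-a] and [e^-b] as multiples of [e^-(a + b)] exposes the common factor
     [e^a + e^b]. *)
  have -> : expR (- a) = expR b * expR (- (a + b)).
    by rewrite -expRD; congr expR; ring.
  have -> : expR (- b) = expR a * expR (- (a + b)).
    by rewrite -expRD; congr expR; ring.
  have := expR_ge1Dx (- (a + b)); have := expR_gt0 a; have := expR_gt0 b.
  nra.
Qed.

End MaxDeg2Curvature.

(** * Test functions constant on branches *)

Section Girth5Curvature.
Hypothesis no_triangle : forall x y z, e x y -> e y z -> ~~ e z x.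
Hypothesis no_square : forall x y z w,
  e x y -> e y z -> e z w -> e w x -> x != z -> y = w.

Definition branch x y : pred X := fun v => (v == y) || (e y v && (v != x)).

(** A vertex common to two branches would close a triangle or a square through [x]. *)
Lemma branch_disjoint x y y' v : e x y -> e x y' -> y != y' ->
  branch x y v -> ~~ branch x y' v.
Proof.
move=> ey ey' yy' /orP[/eqP ->|/andP[yv vx]]; apply/negP.
  case/orP => [|/andP[y'y _]]; first by rewrite (negPf yy').
  by have := no_triangle ey' y'y; rewrite e_sym ey.
case/orP => [/eqP vy'|/andP[y'v _]].
  by have := no_triangle ey yv; rewrite vy' e_sym ey'.
case/eqP: yy'; apply: (no_square ey yv) => //; rewrite 1?e_sym //.
by rewrite eq_sym.
Qed.

(** The branches at [x] are disjoint, so at most one summand is nonzero; [x] and all vertices beyond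
    distance two get [0]. *)
Definition branch_fun (a : X -> R) x v : R :=
  \sum_(y <- N x) if branch x y v then a y else 0.

Lemma branch_fun_bounded a x :
  exists M : R, forall v, `|branch_fun a x v| <= M.
Proof.
exists (\sum_(y <- N x) `|a y|) => v; apply: le_trans (ler_norm_sum _ _ _) _.
by apply: ler_sum => y _; case: ifP; rewrite ?normr0.
Qed.

Lemma branch_funE a x y v : e x y -> branch x y v -> branch_fun a x v = a y.
Proof.
move=> exy xyv; rewrite /branch_fun (bigD1_seq y) ?mem_N //= xyv big_seq_cond.
rewrite big1 ?addr0 // => z; rewrite mem_N => /andP[xz zy].
by rewrite (negPf (branch_disjoint exy xz _ xyv)) // eq_sym.
Qed.

Lemma branch_fun_root a x : branch_fun a x x = 0.
Proof.
rewrite /branch_fun big_seq big1 // => y; rewrite mem_N /branch eqxx andbF orbF.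
by move=> /andP[/negPf ->].
Qed.

Lemma branch_fun_nbr a x y : e x y -> branch_fun a x y = a y.
Proof. by move=> exy; apply: branch_funE; rewrite // /branch eqxx. Qed.

(** The function is constant on each branch, so of the second-order terms only the way back to [x]
    remains. *)
Lemma branch_fun_Psi2 a x (A := \sum_(y <- N x) a y)
    (P := \sum_(y <- N x) Upsilon (a y)) :
  2 * Psi2_Upsilon k (branch_fun a x) x =
  \sum_(y <- N x) (Upsilon (- a y) + (expR (a y) - 1) * (a y + A) - P).
Proof.
rewrite Psi2_nbrs; set f := branch_fun a x.
have fN y : y \in N x -> f y - f x = a y.
  by rewrite mem_N => xy; rewrite /f branch_fun_root subr0 branch_fun_nbr.
have -> : Psi_Upsilon k f x = P.
  by rewrite Psi_nbrs; apply: eq_big_seq => y /fN ->.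
have -> : generator k f x = A.
  by rewrite generator_nbrs; apply: eq_big_seq => y /fN ->.
apply: eq_big_seq => y yx; have exy : e x y by rewrite -mem_N.
rewrite second_nbrs_termE // -(opprB (f y)) (fN _ yx) big_seq big1 => [|z].
  by ring.
rewrite (mem_rem_uniq _ (N_uniq y)) !inE mem_N => /andP[zx yz].
have -> : f z = f y.
  by rewrite /f (branch_fun_nbr _ exy) (branch_funE _ exy) // /branch yz zx orbT.
by rewrite subrr Upsilon0 mulr0 subrr.
Qed.

(* [t = 6] makes [e^-t - e^(t-1) (e - 2) + 6 - 4 t e^(1-t)] negative; this bounds
   [2 Psi_2] for the function below, equal to [t] on one branch and to [1 - t] on
   two others. *)
Lemma CD_max_deg2 : CD_Upsilon_infty k 0 -> max_deg2 e.
Proof.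
move=> CD x y1 y2 y3 ey1 ey2 ey3.
have [->|y12] := eqVneq y1 y2; first exact: Or31.
have [->|y13] := eqVneq y1 y3; first exact: Or32.
have [->|y23] := eqVneq y2 y3; [exact: Or33|exfalso].
(* Here [t = 6] and [1 - t = -5]; the increments add up to [-4]. *)
pose a y : R := if y == y1 then 6 else if y \in [:: y2; y3] then - 5 else 0.
pose s := [seq y <- N x | y \notin [:: y1; y2; y3]].
have Ns : perm_eq (N x) [:: y1, y2, y3 & s].
  apply: uniq_perm => //=.
    rewrite !inE !negb_or y12 y13 y23 filter_uniq // !mem_filter !inE !eqxx.
    by rewrite !orbT.
  move=> y; rewrite mem_N !inE mem_filter !inE mem_N.
  have [->|_] := eqVneq y y1; first exact: ey1.
  have [->|_] := eqVneq y y2; first exact: ey2.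
  by have [->|_] := eqVneq y y3; first exact: ey3.
have a1 : a y1 = 6 by rewrite /a eqxx.
have a2 : a y2 = - 5 by rewrite /a (eq_sym y2 y1) (negPf y12) !inE eqxx.
have a3 : a y3 = - 5 by rewrite /a (eq_sym y3 y1) (negPf y13) !inE eqxx orbT.
have as_ y : y \in s -> a y = 0.
  rewrite mem_filter /a !inE !negb_or.
  by case/andP=> /and3P[/negPf -> /negPf -> /negPf ->].
have := CD _ (branch_fun_bounded a x) x.
rewrite mul0r -(pmulr_rge0 _ (ltr0n _ 2)) branch_fun_Psi2.
rewrite !(perm_big _ Ns) /= !big_cons a1 a2 a3.
rewrite (@big1_seq _ _ _ _ s xpredT a) => [|y /andP[_ /as_] //].
rewrite (@big1_seq _ _ _ _ s xpredT (fun y => Upsilon (a y))); last first.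
  by move=> y /andP[_ /as_] ->; rewrite Upsilon0.
rewrite opprK => Psi2_ge0.
set rest := \sum_(y <- s) _ in Psi2_ge0.
have rest_le0 : rest <= 0.
  rewrite /rest big_seq; apply: sumr_le0 => y /as_ ->.
  rewrite oppr0 Upsilon0 expR0 subrr mul0r !add0r oppr_le0.
  by have := Upsilon_ge0 (6 : R); have := Upsilon_ge0 (- 5 : R); lra.
(* From [e >= (3/2)^2 = 9/4] and [e^5 >= (9/4)^5 > 57] one gets [e^6 - 2 e^5 >= e^5 / 4 > 14], while
   [e^-6 + 6 <= 7]. *)
have e1 : 9/4 <= expR 1 :> R.
  have : 3/2 <= expR (1/2) :> R by have := expR_ge1Dx (1/2 : R); lra.
  have -> : expR 1 = expR (1/2) * expR (1/2) :> R by rewrite -expRD; congr expR; lra.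
  by nra.
have e5 : 57 <= expR 5 :> R.
  have -> : expR 5 = expR 1 ^+ 5 :> R by rewrite -expRM_natl mulr1.
  apply: le_trans (lerXn2r 5 _ _ e1); rewrite ?nnegrE ?expR_ge0 //; lra.
have e6 : expR 6 = expR 1 * expR 5 :> R by rewrite -expRD; congr expR; lra.
have em6 : expR (- 6) <= 1 :> R by rewrite expR_le1; lra.
have em5 : 0 < expR (- 5) :> R by exact: expR_gt0.
move: Psi2_ge0; rewrite /Upsilon opprK e6.
have : 9/4 * expR 5 <= expR 1 * expR 5 :> R by rewrite ler_pM2r // expR_gt0.
move: (expR 1 * expR 5) => E6.
lra.
Qed.

End Girth5Curvature.
End LocallyFinite.

Lemma ucycle_girth (R : realType) (X : eqType) (e : rel X) (n : nat) :
  (n%:R%:E <= girth R e)%E ->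
  forall s, ucycle e s -> (2 < size s)%N -> (n <= size s)%N.
Proof.
move=> en s es s2; rewrite -(ler_nat R) -lee_fin; apply: le_trans en _.
by apply: ereal_inf_lbound; exists s.
Qed.

(** * The graph of the chain *)

Section ChainGraph.
Variables (R : realType) (X : countType) (k : X -> X -> R) (pi : X -> R).
Hypothesis hk : chain_assumptions k pi.
Hypothesis hunw : unweighted k.
Let e := underlying_graph k.

Lemma unweighted_edge x y : e x y -> k x y = 1.
Proof. by case/andP => /hunw[->|->]; rewrite ?ltxx. Qed.

Lemma unweighted_nonedge x y : x != y -> ~~ e x y -> k x y = 0.
Proof.
move=> xy; rewrite /e /underlying_graph xy /=.
by have [->|->] := hunw xy; rewrite ?ltr01.
Qed.

Lemma underlying_graph_irr : irreflexive e.
Proof. by move=> x; rewrite /e /underlying_graph eqxx. Qed.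

Lemma underlying_graph_sym : symmetric e.
Proof.
move=> x y; rewrite /e /underlying_graph eq_sym; congr (_ && _).
rewrite -(pmulr_rgt0 (k x y) (chain_pi_gt0 hk x)).
by rewrite (chain_detailed_balance hk) pmulr_rgt0 // (chain_pi_gt0 hk).
Qed.

Lemma underlying_graph_conn x y : exists p, path e x p /\ last x p = y.
Proof.
have [p [_ kp lp]] := chain_irreducible hk x y; exists p; split=> //.
apply: sub_path kp => a b kab; rewrite /e /underlying_graph kab andbT.
(* Diagonal rates are negative, so a step of positive rate joins distinct vertices. *)
apply: contraTneq kab => <-; rewrite -leNgt.
by have [_ /(_ a)[_ /ltW]] := chain_rates hk.
Qed.

Lemma underlying_graph_nbr x : exists y, e x y.
Proof.
have [_ /(_ x)[kxx kx_lt0]] := chain_rates hk; apply: contrapT => /forallNP ne.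
move: kx_lt0; rewrite -lte_fin kxx /out_rate esum1 ?oppe0 ?ltxx // => y /= /eqP yx.
by rewrite unweighted_nonedge 1?eq_sym //; apply/negP/ne.
Qed.

(** Each neighbour adds [1] to the rate out of [x], which is the real number [- k x x]. *)
Lemma finite_nbrs x : finite_set [set y | e x y].
Proof.
have [_ /(_ x)[kxx kx_lt0]] := chain_rates hk; apply: contrapT => inf.
have [B Bsub Bsize] := infinite_set_fset (Num.bound (- k x x)) inf.
have : (out_rate k x <= (- k x x)%:E)%E by rewrite EFinN kxx oppeK.
apply/negP; rewrite -ltNge.
apply: (@lt_le_trans _ _ ((Num.bound (- k x x))%:R%:E)).
  by rewrite lte_fin archi_boundP // oppr_ge0 ltW.
pose s : seq X := finmap.enum_fset B.
have s_edge y : y \in s -> e x y by move=> ys; exact: Bsub.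
apply: esum_ge; exists [set` s].
  split=> [|y /s_edge/andP[xy _] /= yx]; first exact: finite_seq.
  by rewrite yx eqxx in xy.
rewrite -fsbig_seq ?finmap.fset_uniq //= sumEFin lee_fin.
rewrite (@eq_big_seq _ _ _ _ _ _ (fun=> 1)); last first.
  by move=> y /s_edge; exact: unweighted_edge.
by rewrite big_const_seq count_predT iter_addr_0 ler_nat.
Qed.

Lemma nbrs_seq : exists N : X -> seq X,
  (forall x, uniq (N x)) /\ forall x y, (y \in N x) = e x y.
Proof.
have nbrs x : exists s : seq X, uniq s /\ forall y, (y \in s) = e x y.
  have /finite_seqP[s es] := finite_nbrs x.
  exists (undup s); split=> [|y]; first exact: undup_uniq.
  rewrite mem_undup; apply/idP/idP => [ys|ey].
    by have : [set` s] y by []; rewrite -es.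
  by have : [set y | e x y] y by []; rewrite es.
exists (fun x => projT1 (cid (nbrs x))).
by split=> x; case: cid => s [].
Qed.

End ChainGraph.

Theorem corollary5p17 (R : realType) (X : countType) (k : X -> X -> R)
    (pi : X -> R) (hk : chain_assumptions k pi) (hunw : unweighted k)
    (hgirth : (5%:E <= girth R (underlying_graph k))%E) :
  CD_Upsilon_infty k 0 <->
  (is_path_graph (underlying_graph k)
   \/ exists2 n : nat, (5 <= n)%N &
        graph_iso (underlying_graph k) (@cycle_graph n)).
Proof.
have e_edge := unweighted_edge hunw; have e_non := unweighted_nonedge hunw.
have e_irr := underlying_graph_irr k; have e_sym := underlying_graph_sym hk.
have e_conn := underlying_graph_conn hk; have e_nbr := underlying_graph_nbr hk hunw.
have e_girth := ucycle_girth hgirth.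
have [N [N_uniq mem_N]] := nbrs_seq hk hunw.
(* The nonzero invariant density supplies a starting vertex for the walk. *)
have [x0 _] : exists x : X, pi x != 0 by case: (chain_pi_invariant hk).
have e_neq x y : underlying_graph k x y -> x != y by case/andP.
split=> [CD|]; last first.
  move=> pc; apply: (max_deg2_CD e_edge e_non N_uniq mem_N e_sym).
  by case: pc => [/path_graph_max_deg2|[n _ /cycle_graph_max_deg2]].
apply: (max_deg2_path_or_cycle e_sym e_irr e_conn _ x0 e_nbr e_girth).
apply: (CD_max_deg2 e_edge e_non N_uniq mem_N e_sym) CD.
- move=> x y z xy yz; apply/negP => zx.
  have := e_girth [:: x; y; z]; rewrite /ucycle /= xy yz zx !inE negb_or.
  by rewrite (e_neq _ _ xy) (e_neq _ _ yz) eq_sym (e_neq _ _ zx) => /(_ isT isT).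
- move=> x y z w xy yz zw wx xz; apply/eqP; apply: contraT => yw.
  have := e_girth [:: x; y; z; w]; rewrite /ucycle /= xy yz zw wx !inE !negb_or.
  rewrite (e_neq _ _ xy) xz (e_neq _ _ yz) yw (e_neq _ _ zw) [x == w]eq_sym.
  by rewrite (e_neq _ _ wx) => /(_ isT isT).
Qed.
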